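(* Assume that every loss function $\phi_i$ ($i=1,\dots,n$) is convex and $l_i$-smooth, i.e. $\|\nabla\phi_i(x)-\nabla\phi_i(y)\|\le l_i\|x-y\|$ for all $x,y\in\mathbb{R}^m$, with $l_i>0$. Let $w^*$ be the minimizer of $P$ and $\alpha_i^*=-\nabla\phi_i(A_i^\top w^* )$. Run Algorithm dfSDCA (described in the context) with a stepsize $\theta>0$ satisfying $$\theta\le\min_i\frac{p_in\lambda}{l_iv_i+n\lambda},$$ and define the potential $$E^{(t)}=\frac{\lambda}{2}\|w^{(t)}-w^*\|^2+\frac{1}{2n}\sum_{i=1}^n\frac{1}{l_i}\|\alpha_i^{(t)}-\alpha_i^*\|^2 .$$ Then for all $t\ge0$, $$\mathbf{E}\left[E^{(t)}\right]\le e^{-\theta t}E^{(0)} .$$ Moreover, if $\theta$ is set equal to the upper bound $\min_i\frac{p_in\lambda}{l_iv_i+n\lambda}$, then for every $\epsilon>0$ and every number of iterations $T$, $$T\ge\max_i\left(\frac1{p_i}+\frac{l_iv_i}{\lambda p_in}\right)\log\left(\frac{(L+\lambda)E^{(0)}}{\lambda\epsilon}\right)\quad\Longrightarrow\quad\mathbf{E}\left[P(w^{(T)})-P(w^* )\right]\le\epsilon ,$$ where $L=\max_iL_i$ and $L_1,\dots,L_n>0$ are constants such that $\|\nabla\phi_i(A_i^\top w)-\nabla\phi_i(A_i^\top z)\|\le L_i\|w-z\|$ for all $w,z\in\mathbb{R}^d$ and all $i$.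
   Context: Norms are Euclidean and $[n]=\{1,\dots,n\}$. Problem: given $A_1,\dots,A_n\in\mathbb{R}^{d\times m}$, differentiable functions $\phi_1,\dots,\phi_n:\mathbb{R}^m\to\mathbb{R}$ and $\lambda>0$, minimize over $w\in\mathbb{R}^d$ $$P(w)=\frac1n\sum_{i=1}^n\phi_i(A_i^\top w)+\frac{\lambda}{2}\|w\|^2 .$$ Sampling: $\hat S$ is a random subset of $[n]$ with arbitrary distribution, such that $p_i:=\mathbf{Prob}(i\in\hat S)>0$ for all $i$. The numbers $v_1,\dots,v_n>0$ are such that for all $h_1,\dots,h_n\in\mathbb{R}^m$, $$\mathbf{E}\left[\left\|\sum_{i\in\hat S}A_ih_i\right\|^2\right]\le\sum_{i=1}^n p_iv_i\|h_i\|^2 .$$ Algorithm dfSDCA with sampling $\hat S$ and stepsize $\theta$: choose deterministic $\alpha_1^{(0)},\dots,\alpha_n^{(0)}\in\mathbb{R}^m$ and set $w^{(0)}=\frac{1}{\lambda n}\sum_{i=1}^nA_i\alpha_i^{(0)}$. For $t=1,2,\dots$: draw $S_t$ with the same distribution as $\hat S$, independently of the past; for $i\in S_t$ set $$\alpha_i^{(t)}=\alpha_i^{(t-1)}-\theta p_i^{-1}\left(\nabla\phi_i(A_i^\top w^{(t-1)})+\alpha_i^{(t-1)}\right),$$ for $i\notin S_t$ set $\alpha_i^{(t)}=\alpha_i^{(t-1)}$; and set $$w^{(t)}=w^{(t-1)}-\sum_{i\in S_t}\theta(n\lambda p_i)^{-1}A_i\left(\nabla\phi_i(A_i^\top w^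{(t-1)})+\alpha_i^{(t-1)}\right).$$
   Formalization: In the second claim, L_i is taken as a Lipschitz constant of the gradient in w of w ↦ φ_i(A_i^T w), i.e. of A_i∇φ_i(A_i^T w), not of ∇φ_i(A_i^T w) itself; with the latter the claim fails (n=d=m=1, A=2, φ(x)=x²/2, λ=1, T=0). *)

(* Defs.v *)
From HB Require Import structures.
From mathcomp Require Import all_boot all_order all_algebra finmap.
From mathcomp Require Import all_classical all_reals all_analysis.

Set Implicit Arguments.
Unset Strict Implicit.
Unset Printing Implicit Defensive.

Import Order.TTheory GRing.Theory Num.Theory.
Import numFieldNormedType.Exports.

Local Open Scope classical_set_scope.
Local Open Scope ring_scope.

(* The canonical norm of ['cV[R]_k] is the sup norm, so the Euclidean norm is
   defined separately.  Differentiability does not depend on this choice. *)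
Definition enorm (R : realType) (k : nat) (x : 'cV[R]_k) : R :=
  Num.sqrt (\sum_(j < k) x j ord0 ^+ 2).

Definition grad (R : realType) (k : nat) (f : 'cV[R]_k -> R) (x : 'cV[R]_k) :
    'cV[R]_k :=
  \col_(j < k) 'D_(delta_mx j ord0) f x.

Definition lipschitz_grad (R : realType) (k : nat) (l : R)
    (f : 'cV[R]_k -> R) : Prop :=
  forall x y, enorm (grad f x - grad f y) <= l * enorm (x - y).

(* Minimum and maximum of a nonempty finite family; the neutral element
   [f ord0] is itself a member of the family. *)
Definition fmin (R : realType) (n : nat) (f : 'I_n.+1 -> R) : R :=
  \big[Num.min/f ord0]_(i < n.+1) f i.

Definition fmax (R : realType) (n : nat) (f : 'I_n.+1 -> R) : R :=
  \big[Num.max/f ord0]_(i < n.+1) f i.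

(* The loss as a function of the primal variable [w]: its gradient is taken in
   ['cV[R]_d], whereas that of [phi i] is taken in ['cV[R]_m]. *)
Definition composite_loss (R : realType) (n d m : nat)
    (A : 'I_n -> 'M[R]_(d, m)) (phi : 'I_n -> 'cV[R]_m -> R) (i : 'I_n)
    (w : 'cV[R]_d) : R :=
  phi i ((A i)^T *m w).

Definition primal (R : realType) (n d m : nat) (A : 'I_n -> 'M[R]_(d, m))
    (phi : 'I_n -> 'cV[R]_m -> R) (lambda : R) (w : 'cV[R]_d) : R :=
  n%:R^-1 * (\sum_(i < n) composite_loss A phi i w) + lambda / 2 * enorm w ^+ 2.

Section Sampling.
Context {disp : measure_display} {R : realType} {Omega : measurableType disp}.
Context (Pr : probability Omega R) {n : nat}.

Definition random_subset (X : Omega -> {set 'I_n}) : Prop :=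
  forall B : {set 'I_n}, measurable [set omega | X omega = B].

Definition same_law (X Y : Omega -> {set 'I_n}) : Prop :=
  forall B : {set 'I_n},
    Pr [set omega | X omega = B] = Pr [set omega | Y omega = B].

Definition mutually_independent (X : nat -> Omega -> {set 'I_n}) : Prop :=
  forall (J : {fset nat}) (B : nat -> {set {set 'I_n}}),
    Pr (\bigcap_(j in [set` J]) [set omega | X j omega \in B j]) =
    (\prod_(j <- J) Pr [set omega | X j omega \in B j])%E.

Definition incl_prob (Shat : Omega -> {set 'I_n}) (i : 'I_n) : R :=
  fine (Pr [set omega | i \in Shat omega]).

Definition eso (d m : nat) (A : 'I_n -> 'M[R]_(d, m))
    (Shat : Omega -> {set 'I_n}) (v : 'I_n -> R) : Prop :=
  forall h : 'I_n -> 'cV[R]_m,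
    ('E_Pr[fun omega => (enorm (\sum_(i in Shat omega) A i *m h i) ^+ 2)%R] <=
     (\sum_(i < n) incl_prob Shat i * v i * enorm (h i) ^+ 2)%:E)%E.

End Sampling.

(* A state is the pair [(alpha, w)]. *)
Definition dfsdca_init (R : realType) (n d m : nat)
    (A : 'I_n -> 'M[R]_(d, m)) (lambda : R) (alpha0 : 'I_n -> 'cV[R]_m) :
    ('I_n -> 'cV[R]_m) * 'cV[R]_d :=
  (alpha0, (lambda * n%:R)^-1 *: \sum_(i < n) A i *m alpha0 i).

Definition dfsdca_step (R : realType) (n d m : nat)
    (A : 'I_n -> 'M[R]_(d, m)) (phi : 'I_n -> 'cV[R]_m -> R) (lambda : R)
    (p : 'I_n -> R) (theta : R) (S : {set 'I_n})
    (s : ('I_n -> 'cV[R]_m) * 'cV[R]_d) : ('I_n -> 'cV[R]_m) * 'cV[R]_d :=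
  let: (alpha, w) := s in
  let u i := grad (phi i) ((A i)^T *m w) + alpha i in
  (fun i => if i \in S then alpha i - (theta * (p i)^-1) *: u i else alpha i,
   w - \sum_(i in S) (theta * (n%:R * lambda * p i)^-1) *: (A i *m u i)).

(* [S t] is the subset drawn at iteration [t.+1], i.e. the one that leads from
   the [t]-th state to the [t.+1]-st. *)
Fixpoint dfsdca (R : realType) (n d m : nat)
    (A : 'I_n -> 'M[R]_(d, m)) (phi : 'I_n -> 'cV[R]_m -> R) (lambda : R)
    (p : 'I_n -> R) (theta : R) (alpha0 : 'I_n -> 'cV[R]_m)
    (S : nat -> {set 'I_n}) (t : nat) : ('I_n -> 'cV[R]_m) * 'cV[R]_d :=
  if t is t'.+1 then
    dfsdca_step A phi lambda p theta (S t')
      (dfsdca A phi lambda p theta alpha0 S t')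
  else dfsdca_init A lambda alpha0.

Definition potential (R : realType) (n d m : nat)
    (A : 'I_n -> 'M[R]_(d, m)) (phi : 'I_n -> 'cV[R]_m -> R) (lambda : R)
    (l : 'I_n -> R) (wstar : 'cV[R]_d)
    (s : ('I_n -> 'cV[R]_m) * 'cV[R]_d) : R :=
  let alphastar i := - grad (phi i) ((A i)^T *m wstar) in
  lambda / 2 * enorm (s.2 - wstar) ^+ 2 +
  (2 * n%:R)^-1 * \sum_(i < n) (l i)^-1 * enorm (s.1 i - alphastar i) ^+ 2.

(* Main.v *)
Require Import Defs.
From HB Require Import structures.
From mathcomp Require Import all_boot all_order all_algebra finmap.
From mathcomp Require Import all_classical all_reals all_analysis.
From mathcomp Require Import ring lra.

Import Order.TTheory GRing.Theory Num.Theory.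
Import numFieldNormedType.Exports.

Local Open Scope classical_set_scope.
Local Open Scope ring_scope.

(* With [z_i = alpha_i - alpha_i^*], [g_i] the variation of the [i]-th gradient
   between [w^*] and [w], and [u_i = g_i + z_i], first-order optimality of
   [w^*] gives [w - w^* = (lambda n)^-1 sum_i A_i z_i].  Expanding the squares,
   the sampling inequality bounds the second-order term of the primal part of
   the potential, [2 <z_i, u_i> = |u_i|^2 + |z_i|^2 - |g_i|^2] rewrites the
   cross term of the dual part, and cocoercivity of the gradients,
   [l_i^-1 |g_i|^2 <= <g_i, A_i^T (w - w^* )>], absorbs [|g_i|^2].  The stepsize
   condition makes the total coefficient of [|u_i|^2] nonpositive, so that one
   step contracts the expected potential by [1 - theta <= exp(- theta)].  The
   primal gap is at most [(L + lambda) / 2 * |w - w^*|^2].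
   The state after [t] steps is a function of the first [t] sampled subsets, so
   every expectation is a finite sum over such histories. *)

(** * Euclidean inner product and smooth convex functions *)

Section InnerProduct.
Context {R : realType}.

Definition dotv {k : nat} (x y : 'cV[R]_k) : R :=
  \sum_(j < k) x j ord0 * y j ord0.

Section DotTheory.
Context {k : nat}.
Implicit Types (x y z : 'cV[R]_k) (c : R).

Lemma dotvC x y : dotv x y = dotv y x.
Proof. by apply: eq_bigr => j _; rewrite mulrC. Qed.

Lemma dotvDl x y z : dotv (x + y) z = dotv x z + dotv y z.
Proof. by rewrite -big_split; apply: eq_bigr => j _; rewrite mxE mulrDl. Qed.

Lemma dotvZl c x z : dotv (c *: x) z = c * dotv x z.
Proof. by rewrite mulr_sumr; apply: eq_bigr => j _; rewrite mxE mulrA. Qed.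

Lemma dotvNl x z : dotv (- x) z = - dotv x z.
Proof. by rewrite -scaleN1r dotvZl mulN1r. Qed.

Lemma dot0v z : dotv 0 z = 0.
Proof. by rewrite -(scale0r 0) dotvZl mul0r. Qed.

Lemma dotvDr x y z : dotv z (x + y) = dotv z x + dotv z y.
Proof. by rewrite dotvC dotvDl 2!(dotvC z). Qed.

Lemma dotvZr c x z : dotv z (c *: x) = c * dotv z x.
Proof. by rewrite dotvC dotvZl (dotvC z). Qed.

Lemma dotvNr x z : dotv z (- x) = - dotv z x.
Proof. by rewrite dotvC dotvNl (dotvC z). Qed.

Lemma dotv_suml (I : Type) (r : seq I) (P : pred I) (F : I -> 'cV[R]_k) z :
  dotv (\sum_(i <- r | P i) F i) z = \sum_(i <- r | P i) dotv (F i) z.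
Proof.
by apply: (big_morph (dotv^~ z)) => [x y|]; rewrite ?dotvDl ?dot0v.
Qed.

Lemma dotv_ge0 x : 0 <= dotv x x.
Proof. by apply: sumr_ge0 => j _; rewrite -expr2 sqr_ge0. Qed.

Lemma enorm_ge0 x : 0 <= enorm x.
Proof. exact: sqrtr_ge0. Qed.

Lemma enormZ c x : enorm (c *: x) = `|c| * enorm x.
Proof.
rewrite /enorm -sqrtr_sqr -sqrtrM ?sqr_ge0// mulr_sumr.
by under eq_bigr do rewrite mxE exprMn.
Qed.

Lemma enorm_sqr x : enorm x ^+ 2 = dotv x x.
Proof. by rewrite sqr_sqrtr// sumr_ge0// => j _; rewrite sqr_ge0. Qed.

Definition dotvE := (dotvDl, dotvDr, dotvNl, dotvNr, dotvZl, dotvZr).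

Lemma dotv_eq0 x : (forall h, dotv x h = 0) -> x = 0.
Proof.
move=> x0; apply/colP => i; rewrite mxE -(x0 (delta_mx i ord0)) /dotv.
rewrite (bigD1 i)//= !mxE !eqxx mulr1 big1 ?addr0// => j ji.
by rewrite mxE (negbTE ji) mulr0.
Qed.

Lemma enorm_eq0 x : enorm x = 0 -> x = 0.
Proof.
move=> x0; have /eqP := enorm_sqr x; rewrite x0 expr0n eq_sym psumr_eq0.
  move=> /allP xj; apply/colP => j; rewrite mxE.
  by have := xj j (mem_index_enum _); rewrite -expr2 sqrf_eq0 => /eqP.
by move=> j _; rewrite -expr2 sqr_ge0.
Qed.

(** Cauchy-Schwarz: the square of [enorm y *: x - enorm x *: y] is nonnegative and equals the gap
    times [2 * (enorm x * enorm y)], which is positive once zero norms are set aside. *)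
Lemma dotv_le_enorm x y : dotv x y <= enorm x * enorm y.
Proof.
have [/enorm_eq0->|x0] := eqVneq (enorm x) 0.
  by rewrite dot0v mulr_ge0// enorm_ge0.
have [/enorm_eq0->|y0] := eqVneq (enorm y) 0.
  by rewrite dotvC dot0v mulr_ge0// enorm_ge0.
have xy0 : 0 < 2 * (enorm x * enorm y).
  by rewrite !mulr_gt0// lt_def ?x0 ?y0 enorm_ge0.
have := dotv_ge0 (enorm y *: x - enorm x *: y).
rewrite !dotvE -!enorm_sqr (dotvC y x) => h.
rewrite -subr_ge0 -(pmulr_rge0 _ xy0); move: h; congr (0 <= _); ring.
Qed.

End DotTheory.

Lemma dotv_mulmx {d m : nat} (A : 'M[R]_(d, m)) x r :
  dotv (A *m x) r = dotv x (A^T *m r).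
Proof.
rewrite /dotv; under eq_bigr do rewrite mxE mulr_suml.
rewrite exchange_big; apply: eq_bigr => j _; rewrite mxE mulr_sumr.
by apply: eq_bigr => i _; rewrite mxE; ring.
Qed.

End InnerProduct.

(** Dividing by [t] and letting it tend to 0 would do; the single value [t = a / (a + |K| + 1)]
    replaces the limit. Only [t] in (0, 1] is tested because convexity supplies no others. *)
Lemma le0_of_le_sqr {R : realFieldType} (a K : R) :
  (forall t, 0 < t -> t <= 1 -> t * a <= K * t ^+ 2) -> a <= 0.
Proof.
move=> aK; rewrite leNgt; apply/negP => a0.
pose M := a + `|K| + 1; have M0 : 0 < M by rewrite /M; have := normr_ge0 K; lra.
have t0 : 0 < a / M by rewrite divr_gt0.
have t1 : a / M <= 1 by rewrite ler_pdivrMr// mul1r /M; have := normr_ge0 K; lra.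
have := aK _ t0 t1; rewrite expr2 mulrCA ler_pM2l// => h.
have : a * M <= K * a by rewrite -ler_pdivlMr// -mulrA.
have : K * a <= `|K| * a by rewrite ler_pM2r// ler_norm.
have : 0 < a * a by rewrite mulr_gt0.
rewrite /M; lra.
Qed.

(** First-order condition at a minimum with quadratic remainder: both signs of [t] are tested. *)
Lemma eq0_of_le_sqr {R : realFieldType} (a K : R) :
  (forall t, 0 <= t * a + K * t ^+ 2) -> a = 0.
Proof.
move=> aK; apply/eqP; rewrite eq_le; apply/andP; split.
  by apply: (@le0_of_le_sqr _ _ K) => t _ _; have := aK (- t); rewrite sqrrN; lra.
rewrite -oppr_le0; apply: (@le0_of_le_sqr _ _ K) => t _ _.
by have := aK t; lra.
Qed.

Section SmoothFunctions.
Context {R : realType}.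

(** Gateaux form of differentiability. It passes to the composite losses, since a linear map sends
    lines to lines. *)
Definition has_gradient {k : nat} (f : 'cV[R]_k -> R) : Prop :=
  forall x h, is_derive x h f (dotv (grad f x) h).

Lemma differentiable_has_gradient {k : nat} (f : 'cV[R]_k -> R) :
  (forall x, differentiable f x) -> has_gradient f.
Proof.
move=> df x h; apply: DeriveDef; first exact: diff_derivable.
rewrite deriveE// [in LHS](matrix_sum_delta h) linear_sum.
apply: eq_bigr => i _; rewrite big_ord_recl big_ord0 addr0 linearZ mxE deriveE//.
by rewrite mulrC.
Qed.

(* A directional derivative only involves the restriction of the function to a
   line, so no differentiability of the linear map [A^T] is needed. *)
Lemma composite_derive {d m : nat} (f : 'cV[R]_m -> R) (A : 'M[R]_(d, m)) w h :
  has_gradient f ->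
  is_derive w h (fun w => f (A^T *m w)) (dotv (A *m grad f (A^T *m w)) h).
Proof.
move=> df; have [dv vE] := df (A^T *m w) (A^T *m h).
have E : (fun t : R => t^-1 *: (((fun w => f (A^T *m w)) \o shift w) (t *: h)
            - f (A^T *m w))) =
         (fun t => t^-1 *: ((f \o shift (A^T *m w)) (t *: (A^T *m h))
            - f (A^T *m w))).
  by apply/funext => t /=; rewrite mulmxDr -scalemxAr.
apply: DeriveDef; first by rewrite /derivable E.
by rewrite /derive E dotv_mulmx; exact: vE.
Qed.

Lemma grad_composite {d m : nat} (f : 'cV[R]_m -> R) (A : 'M[R]_(d, m)) w :
  has_gradient f ->
  grad (fun w => f (A^T *m w)) w = A *m grad f (A^T *m w).
Proof.
move=> df; apply/colP => j; rewrite mxE.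
have [_ ->] := composite_derive _ A w (delta_mx j ord0) df.
rewrite /dotv (bigD1 j)//= [X in _ * X]mxE !eqxx mulr1 big1 ?addr0// => i ij.
by rewrite [X in _ * X]mxE (negbTE ij) mulr0.
Qed.

Lemma has_gradient_composite {d m : nat} (f : 'cV[R]_m -> R)
    (A : 'M[R]_(d, m)) :
  has_gradient f -> has_gradient (fun w => f (A^T *m w)).
Proof. by move=> df x h; rewrite grad_composite//; exact: composite_derive. Qed.

Section Smooth.
Context {k : nat} (f : 'cV[R]_k -> R) (l : R).
Hypothesis df : has_gradient f.
Hypothesis lf : lipschitz_grad l f.

Lemma derive_line x h (t : R) :
  is_derive t 1 (fun t => f (x + t *: h)) (dotv (grad f (x + t *: h)) h).
Proof.
have [dv vE] := df (x + t *: h) h.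
have E : (fun s : R => s^-1 *: (((fun t => f (x + t *: h)) \o shift t) (s *: 1)
            - f (x + t *: h))) =
         (fun s => s^-1 *: ((f \o shift (x + t *: h)) (s *: h)
            - f (x + t *: h))).
  apply/funext => s /=; congr (_ *: (f _ - _)).
  by rewrite scalerDl [s%:A]mulr1 addrCA addrA.
apply: DeriveDef; first by rewrite /derivable E.
by rewrite /derive E; exact: vE.
Qed.

(** A monotonicity argument along the segment from [x] to [x + h] replaces integration of the
    gradient; the signs [s = 1] and [s = -1] give the two sides of the absolute value. *)
Lemma taylor_bound x h :
  `|f (x + h) - f x - dotv (grad f x) h| <= l / 2 * enorm h ^+ 2.
Proof.
pose c := l * dotv h h / 2; pose b := dotv (grad f x) h.
have mono (s : R) : `|s| = 1 ->
    s * (f (x + h) - f x - b) <= l / 2 * enorm h ^+ 2.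
  move=> s1.
  pose F (t : R) := f (x + t *: h).
  (* The subtracted quadratic has derivative [c * (2 * t)], exactly the Lipschitz bound on the
     variation of the slope, so [g] is nonincreasing on [0, 1]. *)
  pose g : R -> R := s *: F - (s * b) *: id - c *: (id ^+ 2).
  have gE t : g t = s * (F t - t * b) - c * t ^+ 2.
    rewrite /g !fctE /GRing.scale /=; ring.
  have dg (t : R) : is_derive t 1 g
      (s * (dotv (grad f (x + t *: h)) h - b) - c * (2 * t)).
    have dl : is_derive t 1 F _ := derive_line x h t.
    apply: is_derive_eq; rewrite expr1 /GRing.scale /=; ring.
  have dgc : {within `[(0 : R), 1], continuous g}.
    by apply: derivable_within_continuous => t _; have [] := dg t.
  have : g 1 <= g 0.
    apply: (ler0_derive1_nincr _ _ dgc) => // t; rewrite ?in_itv /= => /andP[t0 t1].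
    rewrite derive1E; have [_ ->] := dg t.
    have : s * (dotv (grad f (x + t *: h)) h - b) <= l * enorm (t *: h) * enorm h.
      rewrite /b -dotvNl -dotvDl -dotvZl (le_trans (dotv_le_enorm _ _))//.
      rewrite ler_wpM2r ?enorm_ge0//.
      have -> : enorm (s *: (grad f (x + t *: h) - grad f x)) =
                enorm (grad f (x + t *: h) - grad f x).
        by rewrite enormZ s1 mul1r.
      by rewrite (le_trans (lf _ _))// addrAC subrr add0r.
    have -> : l * enorm (t *: h) * enorm h = c * (2 * t).
      by rewrite enormZ gtr0_norm// /c -enorm_sqr; field.
    lra.
  rewrite !gE /F scale1r scale0r addr0 expr1n expr0n enorm_sqr /c /=; lra.
rewrite ler_norml; apply/andP; split.
  by have := mono (-1); rewrite normrN1 mulN1r /b lerNl => /(_ erefl).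
by have := mono 1; rewrite normr1 => /(_ erefl); rewrite mul1r.
Qed.


(** Convexity at [t *: y + (1 - t) *: x] is compared with the lower Taylor bound there: the defect,
    multiplied by [t], is at most a multiple of [t ^+ 2]. *)
Lemma convex_above_tangent x y :
  convex_function [set: convex_lmodType 'cV[R]_k] f ->
  f x + dotv (grad f x) (y - x) <= f y.
Proof.
move=> cf; set D := dotv _ _.
suff : D - (f y - f x) <= 0 by lra.
apply: (@le0_of_le_sqr _ _ (l / 2 * enorm (y - x) ^+ 2)) => t t0 t1.
have := cf (Itv01 (ltW t0) t1) y x; rewrite !inE => /(_ Logic.I Logic.I) /=.
rewrite convRE /= /conv /= => ct.
have := taylor_bound x (t *: (y - x)); rewrite ler_norml => /andP[+ _].
have -> : x + t *: (y - x) = t *: y + (1 - t) *: x.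
  by rewrite scalerBl scale1r scalerBr addrCA.
rewrite !enorm_sqr dotvZr dotvZl dotvZr -/D => tb.
have {}ct : f (t *: y + (1 - t) *: x) <= t * f y + (1 - t) * f x by exact: ct.
move: ct tb; set u := f (_ + _); set e := dotv (y - x) _; lra.
Qed.

(** The tangent inequality is sharpened by the squared gradient variation over [2 * l] ([half]);
    adding it for both orders of the two points cancels the function values. *)
Lemma convex_cocoercive x y : 0 < l ->
  convex_function [set: convex_lmodType 'cV[R]_k] f ->
  l^-1 * enorm (grad f x - grad f y) ^+ 2 <= dotv (x - y) (grad f x - grad f y).
Proof.
move=> l0 cf.
suff half a b : f a + dotv (grad f a) (b - a) +
    (2 * l)^-1 * enorm (grad f a - grad f b) ^+ 2 <= f b.
  have := half x y; have := half y x.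
  move: (grad f x) (grad f y) => gx gy; rewrite invfM !enorm_sqr !dotvE.
  rewrite (dotvC gy gx) (dotvC x gx) (dotvC x gy) (dotvC y gx) (dotvC y gy); lra.
set e := grad f b - grad f a.
(* Compare the tangent at [a] with the Taylor bound around [b] at the point
   [b - e / l], which minimizes the resulting upper bound. *)
have := convex_above_tangent a (b + (- l^-1) *: e) cf.
have := taylor_bound b ((- l^-1) *: e); rewrite ler_norml => /andP[_].
have -> : enorm (grad f a - grad f b) ^+ 2 = enorm e ^+ 2.
  by rewrite -opprB !enorm_sqr dotvNl dotvNr opprK.
have -> : dotv (grad f a) (b + - l^-1 *: e - a) =
    dotv (grad f a) (b - a) - l^-1 * dotv (grad f a) e by rewrite !dotvE; ring.
have -> : dotv (grad f b) (- l^-1 *: e) =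
    - l^-1 * enorm e ^+ 2 - l^-1 * dotv (grad f a) e.
  rewrite dotvZr -[grad f b](subrK (grad f a)) -/e dotvDl enorm_sqr; ring.
have -> : l / 2 * enorm (- l^-1 *: e) ^+ 2 = (2 * l)^-1 * enorm e ^+ 2.
  by rewrite !enorm_sqr dotvZl dotvZr; field; rewrite lt0r_neq0.
(* All multiples of the squared norm of [e] now share one atom, so the goal is linear. *)
have -> : - l^-1 * enorm e ^+ 2 = - (2 * ((2 * l)^-1 * enorm e ^+ 2)).
  by field; rewrite lt0r_neq0.
lra.
Qed.

End Smooth.
End SmoothFunctions.

(** * One step of dfSDCA *)

Section OneStep.
Context {R : realType} {n d m : nat}.
Variables (A : 'I_n.+1 -> 'M[R]_(d, m)) (phi : 'I_n.+1 -> 'cV[R]_m -> R).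
Variables (lambda : R) (l : 'I_n.+1 -> R) (wstar : 'cV[R]_d).
Hypothesis lambda_gt0 : 0 < lambda.
Hypothesis dphi : forall i, has_gradient (phi i).
Hypothesis l_gt0 : forall i, 0 < l i.
Hypothesis lphi : forall i, lipschitz_grad (l i) (phi i).
Hypothesis wstar_min :
  forall w, primal A phi lambda wstar <= primal A phi lambda w.

Let N : R := n.+1%:R.
Let N_gt0 : 0 < N. Proof. exact: ltr0Sn. Qed.

Lemma enormD {k : nat} (x y : 'cV[R]_k) :
  enorm (x + y) ^+ 2 = enorm x ^+ 2 + 2 * dotv x y + enorm y ^+ 2.
Proof. rewrite !enorm_sqr !dotvE (dotvC y x); ring. Qed.

(** Weak form of the vanishing gradient of the objective. Taylor bounds on the losses majorize the
    objective along [wstar + t *: h] by a quadratic in [t], and minimality at [t = 0] kills its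
    linear term. *)
Lemma primal_stationary h :
  N^-1 * \sum_i dotv (A i *m grad (phi i) ((A i)^T *m wstar)) h +
  lambda * dotv wstar h = 0.
Proof.
apply: (@eq0_of_le_sqr _ _ (N^-1 * \sum_i l i / 2 * enorm ((A i)^T *m h) ^+ 2 +
                           lambda / 2 * enorm h ^+ 2)) => t.
have := wstar_min (wstar + t *: h); rewrite -subr_ge0 => /le_trans; apply.
rewrite /primal enormD dotvZr (enormZ t h) exprMn real_normK ?num_real//.
have : \sum_i composite_loss A phi i (wstar + t *: h) <=
    \sum_i composite_loss A phi i wstar +
    t * (\sum_i dotv (A i *m grad (phi i) ((A i)^T *m wstar)) h) +
    t ^+ 2 * \sum_i l i / 2 * enorm ((A i)^T *m h) ^+ 2.
  rewrite !mulr_sumr -!big_split /=; apply: ler_sum => i _.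
  have := taylor_bound _ _ (dphi i) (lphi i)
    ((A i)^T *m wstar) (t *: ((A i)^T *m h)).
  rewrite ler_norml => /andP[_].
  rewrite /composite_loss mulmxDr -scalemxAr enormZ exprMn real_normK ?num_real//.
  rewrite dotvZr dotv_mulmx; lra.
rewrite -/N; set a := \sum_i _; set b := \sum_i _; set c := \sum_i _.
set e := \sum_i _; rewrite -subr_ge0 => H.
have : 0 <= N^-1 * (b + t * c + t ^+ 2 * e - a).
  by rewrite mulr_ge0// invr_ge0 ltW.
move=> H0; rewrite -subr_ge0; move: H0; congr (0 <= _); field.
exact: lt0r_neq0.
Qed.

Let alphastar i := - grad (phi i) ((A i)^T *m wstar).

(** Stationarity in all directions. The optimum thus obeys the same primal-dual relation as the
    iterates, so subtracting the two expresses [w - wstar] through the dual errors. *)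
Lemma wstar_alphastar :
  wstar = (lambda * N)^-1 *: \sum_i A i *m alphastar i.
Proof.
apply/eqP; rewrite -subr_eq0; apply/eqP/dotv_eq0 => h.
rewrite dotvDl dotvNl dotvZl dotv_suml.
under eq_bigr do rewrite mulmxN dotvNl; rewrite sumrN.
have := primal_stationary h; set S := \sum_i _ => S0.
apply: (@mulfI _ lambda); first by rewrite lt0r_neq0.
rewrite mulr0 -S0; field; rewrite !lt0r_neq0//.
Qed.

(** Taylor bounds for the composite losses around [wstar]: stationarity removes the first-order
    terms, and the regularizer adds its exact quadratic. *)
Lemma primal_gap (L : 'I_n.+1 -> R) w :
  (forall i, lipschitz_grad (L i) (composite_loss A phi i)) ->
  primal A phi lambda w - primal A phi lambda wstar <=
  (fmax L + lambda) / 2 * enorm (w - wstar) ^+ 2.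
Proof.
move=> LL; set r := w - wstar.
have -> : w = wstar + r by rewrite addrC subrK.
have : \sum_i composite_loss A phi i (wstar + r) <=
    \sum_i composite_loss A phi i wstar +
    \sum_i dotv (A i *m grad (phi i) ((A i)^T *m wstar)) r +
    N * (fmax L / 2 * enorm r ^+ 2).
  rewrite mulr_natl -[X in _ *+ X](card_ord n.+1) -sumr_const -!big_split /=.
  apply: ler_sum => i _.
  have := taylor_bound _ _ (has_gradient_composite _ (A i) (dphi i)) (LL i)
    wstar r.
  rewrite ler_norml => /andP[_]; rewrite grad_composite//.
  rewrite /composite_loss.
  have : L i * enorm r ^+ 2 <= fmax L * enorm r ^+ 2.
    by rewrite ler_wpM2r ?sqr_ge0// /fmax; exact: le_bigmax.
  lra.
have := primal_stationary r.
set S2 := \sum_i dotv _ _ => st.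
rewrite /primal enormD -/N; set Sa := \sum_i _; set Sb := \sum_i _.
rewrite -subr_ge0 => H; rewrite -subr_ge0.
have : 0 <= N^-1 * (Sb + S2 + N * (fmax L / 2 * enorm r ^+ 2) - Sa) -
            (N^-1 * S2 + lambda * dotv wstar r).
  by rewrite st subr0 mulr_ge0// invr_ge0 ltW.
congr (0 <= _); field.
exact: lt0r_neq0.
Qed.

(** * Contraction of the expected potential, with [q] the law of the sampled subset *)

Section Sampling.
Variables (v p : 'I_n.+1 -> R) (q : {set 'I_n.+1} -> R) (theta : R).
Hypothesis phi_convex :
  forall i, convex_function [set: convex_lmodType 'cV[R]_m] (phi i).
Hypothesis q1 : \sum_B q B = 1.
Hypothesis pE : forall i, p i = \sum_(B : {set 'I_n.+1} | i \in B) q B.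
Hypothesis p_gt0 : forall i, 0 < p i.
Hypothesis v_gt0 : forall i, 0 < v i.
Hypothesis q_eso : forall h : 'I_n.+1 -> 'cV[R]_m,
  \sum_(B : {set 'I_n.+1}) q B * enorm (\sum_(i in B) A i *m h i) ^+ 2 <=
  \sum_i p i * v i * enorm (h i) ^+ 2.
Hypothesis theta_gt0 : 0 < theta.
Hypothesis theta_le :
  forall i, theta <= p i * N * lambda / (l i * v i + N * lambda).

Lemma mean_sum_in (a : 'I_n.+1 -> R) :
  \sum_(B : {set 'I_n.+1}) q B * \sum_(i in B) a i = \sum_i p i * a i.
Proof.
under eq_bigr do rewrite mulr_sumr big_mkcond /=.
rewrite exchange_big; apply: eq_bigr => i _.
by rewrite -big_mkcond/= -mulr_suml pE.
Qed.

Lemma mean_in i (a c : R) :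
  \sum_(B : {set 'I_n.+1}) q B * (a + (if i \in B then c else 0)) =
  a + p i * c.
Proof.
under eq_bigr do rewrite mulrDr; rewrite big_split /= -mulr_suml q1 mul1r pE.
congr (_ + _); rewrite mulr_suml [RHS]big_mkcond; apply: eq_bigr => B _.
by case: ifP; rewrite ?mulr0.
Qed.

(** Scalar core of the contraction: [uu], [zz], [gg] are the squared norms of [u i], [z i], [g i],
    [zu] is the inner product of [z i] and [u i], and [D] is the inner product in the cocoercivity
    bound. *)
Lemma coordinate_decrease i (D uu zu zz gg : R) :
  gg = uu + zz - 2 * zu -> 0 <= uu -> 0 <= gg -> (l i)^-1 * gg <= D ->
  - (theta / N) * D +
  lambda / 2 * (p i * v i * ((theta * (N * lambda * p i)^-1) ^+ 2 * uu)) +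
  (2 * N)^-1 * ((l i)^-1 * (zz + p i * ((theta * (p i)^-1) ^+ 2 * uu -
                                       2 * (theta * (p i)^-1) * zu))) <=
  (1 - theta) * ((2 * N)^-1 * ((l i)^-1 * zz)).
Proof.
move=> ggE uu0 gg0; rewrite mulrC ler_pdivrMr// => ggD.
have := theta_le i; have pi := p_gt0 i; have vi := v_gt0 i.
have li := l_gt0 i; have lv : 0 < l i * v i by rewrite mulr_gt0.
have Nl : 0 < N * lambda by rewrite mulr_gt0.
rewrite ler_pdivlMr ?addr_gt0// => th.
(* The coefficient of [uu] is nonpositive exactly when [ka <= 1], which is the
   stepsize condition. *)
set ka := theta * (l i * v i + N * lambda) / (p i * N * lambda).
have ka1 : ka <= 1 by rewrite /ka ler_pdivrMr ?mul1r// !mulr_gt0.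
rewrite -subr_ge0.
suff -> : (1 - theta) * ((2 * N)^-1 * ((l i)^-1 * zz)) -
 (- (theta / N) * D +
  lambda / 2 * (p i * v i * ((theta * (N * lambda * p i)^-1) ^+ 2 * uu)) +
  (2 * N)^-1 * ((l i)^-1 * (zz + p i * ((theta * (p i)^-1) ^+ 2 * uu -
                                       2 * (theta * (p i)^-1) * zu)))) =
  theta / (2 * N * l i) * (2 * (D * l i) - ka * uu + 2 * zu - zz).
  apply: mulr_ge0; first by rewrite divr_ge0 ?mulr_ge0 ?ltW.
  (* With [ka] replaced by 1 the bracket becomes [2 * (D * l i) - gg], which is at least [gg]. *)
  have : ka * uu <= 1 * uu by rewrite ler_wpM2r.
  lra.
by rewrite /ka; field; rewrite !lt0r_neq0.
Qed.

(** The primal and dual parts are averaged separately, then recombined coordinate by coordinate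
    through [coordinate_decrease]. *)
Lemma expected_step (alpha : 'I_n.+1 -> 'cV[R]_m) (w : 'cV[R]_d) :
  w = (lambda * N)^-1 *: \sum_i A i *m alpha i ->
  \sum_B q B * potential A phi lambda l wstar
                 (dfsdca_step A phi lambda p theta B (alpha, w)) <=
  (1 - theta) * potential A phi lambda l wstar (alpha, w).
Proof.
move=> wE.
pose z i := alpha i - alphastar i.
pose g i := grad (phi i) ((A i)^T *m w) - grad (phi i) ((A i)^T *m wstar).
pose r := w - wstar.
pose u i := grad (phi i) ((A i)^T *m w) + alpha i.
pose c i := theta * (N * lambda * p i)^-1.
have gE i : g i = u i - z i.
  by rewrite /g /u /z /alphastar opprD !opprK addrA addrK.
have rE : \sum_i A i *m z i = (lambda * N) *: r.
  rewrite /r wE wstar_alphastar -scalerBr scalerA mulfV; last first.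
    by rewrite mulf_neq0 ?lt0r_neq0.
  by rewrite scale1r -sumrB; apply: eq_bigr => i _; rewrite -mulmxBr.
(* The sampling inequality is applied to the vectors [c i *: u i]. *)
have primal_part :
    \sum_B q B * enorm (w - \sum_(i in B) c i *: (A i *m u i) - wstar) ^+ 2 <=
    enorm r ^+ 2 - 2 * (\sum_i p i * (c i * dotv (A i *m u i) r)) +
    \sum_i p i * v i * (c i ^+ 2 * enorm (u i) ^+ 2).
  have E (B : {set 'I_n.+1}) :
      enorm (w - \sum_(i in B) c i *: (A i *m u i) - wstar) ^+ 2 =
      enorm r ^+ 2 - 2 * (\sum_(i in B) c i * dotv (A i *m u i) r) +
      enorm (\sum_(i in B) A i *m (c i *: u i)) ^+ 2.
    rewrite addrAC -/r enormD dotvNr dotvC dotv_suml.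
    under [in LHS]eq_bigr do rewrite dotvZl.
    congr (_ + _); first by rewrite mulrN.
    rewrite !enorm_sqr dotvNl dotvNr opprK.
    by under [in RHS]eq_bigr do rewrite -scalemxAr.
  under eq_bigr do rewrite E mulrDr mulrBr (mulrCA _ 2).
  rewrite !big_split /= sumrN -mulr_suml q1 mul1r -mulr_sumr mean_sum_in.
  rewrite lerD2l (le_trans (q_eso _))//; apply: ler_sum => i _.
  by rewrite enormZ exprMn real_normK ?num_real.
have dual_part i :
    \sum_(B : {set 'I_n.+1}) q B * enorm ((if i \in B
      then alpha i - (theta * (p i)^-1) *: u i else alpha i) - alphastar i) ^+ 2
    = enorm (z i) ^+ 2 + p i * ((theta * (p i)^-1) ^+ 2 * enorm (u i) ^+ 2 -
                               2 * (theta * (p i)^-1) * dotv (z i) (u i)).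
  rewrite -mean_in; apply: eq_bigr => B _; congr (_ * _).
  case: ifP => _; last by rewrite addr0.
  rewrite addrAC -/(z i) enormD dotvNr dotvZr !enorm_sqr !dotvE; ring.
(* The product [p i * c i] is [theta / (N * lambda)] for every [i], so the probabilities cancel; by
   [rE] the [z] part of [u] sums to a multiple of [r]. *)
have uE : \sum_i p i * (c i * dotv (A i *m u i) r) =
    theta / (N * lambda) * \sum_i dotv (g i) ((A i)^T *m r) +
    theta * enorm r ^+ 2.
  transitivity (theta / (N * lambda) * \sum_i dotv (A i *m u i) r).
    rewrite mulr_sumr; apply: eq_bigr => i _; rewrite /c; field.
    by rewrite !lt0r_neq0.
  have -> : \sum_i dotv (A i *m u i) r =
      \sum_i dotv (g i) ((A i)^T *m r) + dotv (\sum_i A i *m z i) r.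
    rewrite dotv_suml -big_split; apply: eq_bigr => i _.
    by rewrite /= !dotv_mulmx -dotvDl gE subrK.
  rewrite rE dotvZl enorm_sqr; field; by rewrite !lt0r_neq0.
have -> : \sum_B q B * potential A phi lambda l wstar
                 (dfsdca_step A phi lambda p theta B (alpha, w)) =
  lambda / 2 *
    (\sum_B q B * enorm (w - \sum_(i in B) c i *: (A i *m u i) - wstar) ^+ 2) +
  (2 * N)^-1 * \sum_i (l i)^-1 *
    (\sum_(B : {set 'I_n.+1}) q B * enorm ((if i \in B
      then alpha i - (theta * (p i)^-1) *: u i else alpha i) - alphastar i) ^+ 2).
  under [X in _ = _ + _ * X]eq_bigr do rewrite mulr_sumr.
  rewrite [X in _ = _ + _ * X]exchange_big !mulr_sumr -big_split.
  apply: eq_bigr => B _; rewrite /potential /= mulrDr mulrCA; congr (_ + _).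
  rewrite mulrCA; congr (_ * _); rewrite mulr_sumr; apply: eq_bigr => i _.
  by rewrite mulrCA.
under [X in _ + _ * X]eq_bigr do rewrite dual_part.
(* The cross term yields twice the decrease [theta * (lambda / 2 * |r|^2)]: one copy gives the
   factor [1 - theta], the other is discarded. *)
have : lambda / 2 * (\sum_B q B *
    enorm (w - \sum_(i in B) c i *: (A i *m u i) - wstar) ^+ 2) <=
  (1 - theta) * (lambda / 2 * enorm r ^+ 2) +
  \sum_i (- (theta / N) * dotv (g i) ((A i)^T *m r) +
         lambda / 2 * (p i * v i * (c i ^+ 2 * enorm (u i) ^+ 2))).
  rewrite big_split /= -!mulr_sumr.
  have h2 : 0 < lambda / 2 by rewrite divr_gt0.
  move: primal_part; rewrite uE -(ler_pM2l h2) => /le_trans; apply.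
  set S := \sum_i _; set V := \sum_i _; rewrite -subr_ge0.
  suff -> : forall X : R,
    (1 - theta) * (lambda / 2 * X) + (- (theta / N) * S + lambda / 2 * V) -
     lambda / 2 * (X - 2 * (theta / (N * lambda) * S + theta * X) + V) =
    theta * (lambda / 2 * X).
    by apply: mulr_ge0; [exact: ltW|apply: mulr_ge0; [exact: ltW|exact: sqr_ge0]].
  by move=> X; field; rewrite !lt0r_neq0.
move=> primal_le; apply: (le_trans (lerD primal_le (lexx _))).
rewrite /potential /= -addrA [leRHS]mulrDr lerD2l -/r.
rewrite !mulr_sumr -big_split /=; apply: ler_sum => i _.
apply: (@coordinate_decrease i _ _ _ _ (enorm (g i) ^+ 2)).
- rewrite gE; move: (u i) (z i) => a b.
  rewrite !enorm_sqr !dotvE (dotvC b a); ring.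
- exact: sqr_ge0.
- exact: sqr_ge0.
rewrite dotvC /r mulmxBr; exact: convex_cocoercive.
Qed.

(** Each sampled index moves [w] by [(lambda * N)^-1 *: A i] applied to its dual move, so the
    relation survives whichever subset is drawn. *)
Lemma dual_average_step B (alpha : 'I_n.+1 -> 'cV[R]_m) (w : 'cV[R]_d) :
  w = (lambda * N)^-1 *: \sum_i A i *m alpha i ->
  let s := dfsdca_step A phi lambda p theta B (alpha, w) in
  s.2 = (lambda * N)^-1 *: \sum_i A i *m s.1 i.
Proof.
move=> wE /=; rewrite {1}wE.
rewrite [X in _ - X = _](_ : _ = (lambda * N)^-1 *: \sum_i
   (if i \in B then (theta * (p i)^-1) *: (A i *m
      (grad (phi i) ((A i)^T *m w) + alpha i)) else 0)); last first.
  rewrite [LHS]big_mkcond scaler_sumr; apply: eq_bigr => i _; case: ifP => _.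
    rewrite scalerA; congr (_ *: _); rewrite -/N; field.
    by rewrite !lt0r_neq0.
  by rewrite scaler0.
rewrite -scalerBr -sumrB; congr (_ *: _); apply: eq_bigr => i _.
by case: ifP => _; rewrite ?subr0// mulmxBr -scalemxAr.
Qed.

Lemma dual_average alpha0 (S : nat -> {set 'I_n.+1}) t :
  let s := dfsdca A phi lambda p theta alpha0 S t in
  s.2 = (lambda * N)^-1 *: \sum_i A i *m s.1 i.
Proof.
elim: t => [//|t IH] /=.
by move: IH; case: (dfsdca _ _ _ _ _ _ _ _) => alpha w; exact: dual_average_step.
Qed.

Lemma dual_error_ge0 (alpha : 'I_n.+1 -> 'cV[R]_m) :
  0 <= (2 * N)^-1 * \sum_i (l i)^-1 * enorm (alpha i - alphastar i) ^+ 2.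
Proof.
apply: mulr_ge0; first by rewrite invr_ge0 mulr_ge0 ?ltW.
by apply: sumr_ge0 => i _; rewrite mulr_ge0 ?sqr_ge0// invr_ge0 ltW.
Qed.

Lemma potential_ge0 s : 0 <= potential A phi lambda l wstar s.
Proof.
apply: addr_ge0; last exact: dual_error_ge0.
by apply: mulr_ge0; rewrite ?sqr_ge0 ?divr_ge0 ?ltW.
Qed.

Lemma primal_gap_potential (L : 'I_n.+1 -> R) s :
  0 < fmax L + lambda ->
  (forall i, lipschitz_grad (L i) (composite_loss A phi i)) ->
  primal A phi lambda s.2 - primal A phi lambda wstar <=
  (fmax L + lambda) / lambda * potential A phi lambda l wstar s.
Proof.
move=> M0 LL; apply: (le_trans (primal_gap L s.2 LL)).
rewrite /potential mulrDr ler_wpDr//.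
  by apply: mulr_ge0; [rewrite divr_ge0 ?ltW|exact: dual_error_ge0].
rewrite mulrA ler_wpM2r ?sqr_ge0//.
by rewrite le_eqVlt; apply/orP; left; apply/eqP; field; rewrite lt0r_neq0.
Qed.

End Sampling.
End OneStep.

(** * Finitely valued random variables and the sampling history *)

Section FiniteValued.
Context {disp : measure_display} {Omega : measurableType disp} {R : realType}.
Variable Pr : probability Omega R.

Definition law {T : finType} (X : Omega -> T) (a : T) : R :=
  fine (Pr [set omega | X omega = a]).

Lemma law_ge0 {T : finType} (X : Omega -> T) a : 0 <= law X a.
Proof. exact: fine_ge0. Qed.

(** [random_subset] for an arbitrary finite type, so as to cover histories and pairs. *)
Definition finite_rv {T : finType} (X : Omega -> T) : Prop :=
  forall a, measurable [set omega | X omega = a].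

Lemma finite_rv_measurable {T : finType} (X : Omega -> T) (P : pred T) :
  finite_rv X -> measurable [set omega | P (X omega)].
Proof.
move=> mX; rewrite (_ : [set _ | _] =
  \bigcup_(a in [set a | P a]) [set omega | X omega = a]).
  by apply: fin_bigcup_measurable => // a _; exact: mX.
apply/seteqP; split=> omega /=; first by move=> PX; exists (X omega).
by move=> [a Pa Xa]; rewrite [X _]Xa.
Qed.

(** [F (X omega)] is a finite combination of indicators of the level sets of [X], each
    integrable. *)
Lemma expectation_finite_rv {T : finType} (X : Omega -> T) (F : T -> R) :
  finite_rv X ->
  ('E_Pr[fun omega => F (X omega)] = (\sum_a law X a * F a)%:E)%E.
Proof.
move=> mX.
have -> : (fun omega => F (X omega)) =
    (fun omega => \sum_a F a * \1_[set omega | X omega = a] omega).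
  apply/funext => omega; rewrite (bigD1 (X omega))//= indicE mem_set// mulr1.
  rewrite big1 ?addr0// => a aX; rewrite indicE memNset ?mulr0//=.
  by move=> Xa; rewrite Xa eqxx in aX.
rewrite unlock.
under eq_integral do rewrite -sumEFin.
rewrite integral_sum//; last first.
  move=> a; under eq_fun do rewrite EFinM.
  apply: integrableZl => //; exact: integrable_indic.
rewrite -sumEFin; apply: eq_bigr => a _.
under eq_integral do rewrite EFinM.
rewrite integralZl//; last exact: integrable_indic.
by rewrite integral_indic// setIT muleC EFinM /law fineK ?fin_num_measure.
Qed.

Lemma sum_law {T : finType} (X : Omega -> T) :
  finite_rv X -> \sum_a law X a = 1.
Proof.
move=> mX; have := expectation_finite_rv X (cst 1) mX.
rewrite (_ : (fun _ => _) = cst 1)// expectation_cst => -[->].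
by apply: eq_bigr => a _; rewrite mulr1.
Qed.

Lemma finite_rv_pair {T1 T2 : finType} (X : Omega -> T1) (Y : Omega -> T2) :
  finite_rv X -> finite_rv Y -> finite_rv (fun omega => (X omega, Y omega)).
Proof.
move=> mX mY [a b]; rewrite (_ : [set _ | _] =
  [set omega | X omega = a] `&` [set omega | Y omega = b]).
  exact: measurableI.
by apply/seteqP; split=> omega /= => [[-> ->]|[-> ->]].
Qed.

Lemma incl_prob_law {n : nat} (X : Omega -> {set 'I_n}) i :
  finite_rv X -> incl_prob Pr X i = \sum_(B : {set 'I_n} | i \in B) law X B.
Proof.
move=> mX.
have := expectation_finite_rv X (fun B => (i \in B)%:R) mX.
rewrite (_ : (fun _ => _) = \1_[set omega | i \in X omega]); last first.
  apply/funext => omega; rewrite indicE; congr (nat_of_bool _)%:R.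
  by apply/idP/idP => [iX|]; [exact/mem_set|exact: set_mem].
rewrite expectation_indic; last exact: (finite_rv_measurable X (fun B => i \in B)).
rewrite /incl_prob => -> /=; rewrite big_mkcond [RHS]big_mkcond.
by apply: eq_bigr => B _; case: ifP; rewrite ?mulr1 ?mulr0.
Qed.

End FiniteValued.

(** * Independence of the next draw from the sampling history *)

Section History.
Context {disp : measure_display} {Omega : measurableType disp} {R : realType}.
Variable Pr : probability Omega R.
Context {n : nat}.
Variable S : nat -> Omega -> {set 'I_n}.
Hypothesis mS : forall t, random_subset (S t).
Hypothesis indepS : mutually_independent Pr S.

(** A finite function, so that histories form a finite type. *)
Definition history t (omega : Omega) : {ffun 'I_t -> {set 'I_n}} :=
  [ffun i : 'I_t => S i omega].

(* Only the values below [t] matter; the others are filled with the empty set. *)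
Definition path_of t (b : {ffun 'I_t -> {set 'I_n}}) (j : nat) : {set 'I_n} :=
  oapp b finset.set0 (insub j).

Lemma path_of_history t omega j :
  (j < t)%N -> path_of t (history t omega) j = S j omega.
Proof. by move=> jt; rewrite /path_of insubT/= ffunE. Qed.

Let prefix t : {fset nat} := [fset j in iota 0 t]%fset.

Let mem_prefix t j : (j \in prefix t) = (j < t)%N.
Proof. by rewrite !inE/= mem_iota. Qed.

(** Puts the event in the shape to which [mutually_independent] applies. *)
Lemma history_event t b : [set omega | history t omega = b] =
  \bigcap_(j in [set` prefix t])
    [set omega | S j omega \in [set path_of t b j]%SET].
Proof.
apply/seteqP; split=> omega /=.
  move=> <- j /=; rewrite mem_prefix => jt.
  by rewrite path_of_history// inE.
move=> Sb; apply/ffunP => j; rewrite ffunE.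
have /= := Sb j; rewrite mem_prefix ltn_ord => /(_ isT).
by rewrite inE => /eqP ->; rewrite /path_of valK.
Qed.

Lemma history_finite_rv t : finite_rv (history t).
Proof.
move=> b; rewrite history_event; apply: fin_bigcap_measurable => // j _.
exact: (finite_rv_measurable _ (fun B => B \in [set path_of t b j]%SET) (mS j)).
Qed.

(** Independence is used twice: over the indices up to [t], to split off the factor of index [t],
    and over those below [t], to reassemble the rest into the law of the history. *)
Lemma law_history_next t b B :
  law Pr (fun omega => (history t omega, S t omega)) (b, B) =
  law Pr (history t) b * law Pr (S t) B.
Proof.
pose C j := if j == t then [set B]%SET else [set path_of t b j]%SET.
have CE : [set omega | (history t omega, S t omega) = (b, B)] =
    \bigcap_(j in [set` (t |` prefix t)%fset]) [set omega | S j omega \in C j].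
  apply/seteqP; split=> omega /=.
    move=> [hb SB] j /=; rewrite /C in_fset1U mem_prefix.
    case: eqVneq => [-> _|_ /= jt]; first by rewrite inE SB.
    by rewrite -hb inE path_of_history.
  move=> SC; congr (_, _).
    suff : [set omega | history t omega = b] omega by [].
    rewrite history_event => j /=; rewrite mem_prefix => jt.
    by have := SC j; rewrite /= in_fset1U mem_prefix jt orbT /C ltn_eqF// => /(_ isT).
  have := SC t; rewrite /= in_fset1U eqxx /C eqxx => /(_ isT).
  by rewrite inE => /eqP.
have PE : (\prod_(j <- prefix t) Pr [set omega | S j omega \in C j] =
           Pr [set omega | history t omega = b])%E.
  rewrite history_event indepS big_seq [RHS]big_seq; apply: eq_bigr => j.
  by rewrite mem_prefix /C => jt; rewrite ltn_eqF.
have St : [set omega | S t omega \in C t] = [set omega | S t omega = B].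
  by rewrite /C eqxx; apply/seteqP; split=> omega /=; rewrite inE => /eqP.
rewrite /law CE indepS big_fsetU1/= ?mem_prefix ?ltnn// PE St muleC.
by rewrite fineM//; apply: fin_num_measure; [exact: (history_finite_rv t b)|exact: mS].
Qed.

Lemma expectation_history t (F : {ffun 'I_t -> {set 'I_n}} -> R) :
  ('E_Pr[fun omega => F (history t omega)] =
   (\sum_b law Pr (history t) b * F b)%:E)%E.
Proof. exact: (expectation_finite_rv Pr (history t) F (history_finite_rv t)). Qed.

(** Tower property: the past is frozen while the next draw is averaged. *)
Lemma expectation_history_next t
    (F : {ffun 'I_t -> {set 'I_n}} -> {set 'I_n} -> R) :
  ('E_Pr[fun omega => F (history t omega) (S t omega)] =
   (\sum_b law Pr (history t) b * \sum_B law Pr (S t) B * F b B)%:E)%E.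
Proof.
have := expectation_finite_rv Pr (fun omega => (history t omega, S t omega))
  (fun x => F x.1 x.2).
move=> /= ->; last first.
  by apply: finite_rv_pair; [exact: history_finite_rv|exact: mS].
congr (_%:E).
transitivity (\sum_b \sum_B law Pr (history t) b * (law Pr (S t) B * F b B)).
  rewrite pair_big /=; apply: eq_bigr => -[b B] _ /=.
  by rewrite law_history_next mulrA.
by apply: eq_bigr => b _; rewrite mulr_sumr.
Qed.

End History.

Lemma dfsdca_eq {R : realType} {n d m : nat} (A : 'I_n -> 'M[R]_(d, m)) phi
    lambda p theta alpha0 (S S' : nat -> {set 'I_n}) t :
  (forall j, (j < t)%N -> S j = S' j) ->
  dfsdca A phi lambda p theta alpha0 S t =
  dfsdca A phi lambda p theta alpha0 S' t.
Proof.
elim: t => [//|t IH] SS /=; rewrite SS// IH// => j jt.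
by apply: SS; rewrite (ltn_trans jt).
Qed.

(** Inversion reverses the order on positive reals; this links the iteration count to the largest
    stepsize. *)
Lemma fmax_inv_fmin {R : realType} {n : nat} (f : 'I_n.+1 -> R) :
  (forall i, 0 < f i) -> fmax (fun i => (f i)^-1) = (fmin f)^-1.
Proof.
move=> f0; have m0 : 0 < fmin f by apply/bigmin_gtP.
have fm i : fmin f <= f i by exact: bigmin_le.
have Mf i : (f i)^-1 <= fmax (fun i => (f i)^-1).
  exact: (le_bigmax _ (fun i => (f i)^-1)).
have M0 : 0 < fmax (fun i => (f i)^-1).
  by rewrite (lt_le_trans _ (Mf ord0))// invr_gt0.
apply/eqP; rewrite eq_le; apply/andP; split.
  by apply/bigmax_leP; split=> [|i _]; rewrite lef_pV2 ?posrE.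
rewrite -[leRHS]invrK lef_pV2 ?posrE ?invr_gt0//.
by apply/bigmin_geP; split=> [|i _]; rewrite -[leRHS]invrK lef_pV2 ?posrE ?invr_gt0.
Qed.

(** * Expected potential and expected primal gap along the iterations *)

Section Dfsdca.
Context {R : realType} {n d m : nat} {disp : measure_display}.
Context {Omega : measurableType disp}.
Variable Pr : probability Omega R.
Variables (A : 'I_n.+1 -> 'M[R]_(d, m)) (phi : 'I_n.+1 -> 'cV[R]_m -> R).
Variables (lambda theta : R) (v l : 'I_n.+1 -> R) (wstar : 'cV[R]_d).
Variables (Shat : Omega -> {set 'I_n.+1}) (S : nat -> Omega -> {set 'I_n.+1}).
Variable alpha0 : 'I_n.+1 -> 'cV[R]_m.
Let p := incl_prob Pr Shat.
Let pot := potential A phi lambda l wstar.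
Let state t omega := dfsdca A phi lambda p theta alpha0 (fun k => S k omega) t.
Hypothesis lambda_gt0 : 0 < lambda.
Hypothesis dphi : forall i, has_gradient (phi i).
Hypothesis l_gt0 : forall i, 0 < l i.
Hypothesis lphi : forall i, lipschitz_grad (l i) (phi i).
Hypothesis wstar_min :
  forall w, primal A phi lambda wstar <= primal A phi lambda w.
Hypothesis phi_convex :
  forall i, convex_function [set: convex_lmodType 'cV[R]_m] (phi i).
Hypothesis mShat : random_subset Shat.
Hypothesis p_gt0 : forall i, 0 < p i.
Hypothesis v_gt0 : forall i, 0 < v i.
Hypothesis Shat_eso : eso Pr A Shat v.
Hypothesis mS : forall t, random_subset (S t).
Hypothesis S_law : forall t, same_law Pr (S t) Shat.
Hypothesis indepS : mutually_independent Pr S.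
Hypothesis theta_gt0 : 0 < theta.
Hypothesis theta_le :
  forall i, theta <= p i * n.+1%:R * lambda / (l i * v i + n.+1%:R * lambda).

Let run t (b : {ffun 'I_t -> {set 'I_n.+1}}) :=
  dfsdca A phi lambda p theta alpha0 (path_of t b) t.

(** The expectation at time [t] as a real number, which keeps the recursion out of the extended
    reals. *)
Let mean t (G : ('I_n.+1 -> 'cV[R]_m) * 'cV[R]_d -> R) : R :=
  \sum_b law Pr (history S t) b * G (run t b).

Let stateE t omega : state t omega = run t (history S t omega).
Proof. by apply: dfsdca_eq => j jt; rewrite path_of_history. Qed.

Lemma expectation_state t G :
  ('E_Pr[fun omega => G (state t omega)] = (mean t G)%:E)%E.
Proof.
rewrite -(expectation_history _ _ mS t (fun b => G (run t b))).
by congr expectation; apply/funext => omega; rewrite stateE.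
Qed.

Lemma law_Shat t B : law Pr (S t) B = law Pr Shat B.
Proof. by rewrite /law S_law. Qed.

Lemma mean_potential_step t : mean t.+1 pot <= (1 - theta) * mean t pot.
Proof.
rewrite -lee_fin -expectation_state.
rewrite (_ : (fun omega => _) = (fun omega => pot (dfsdca_step A phi lambda p
    theta (S t omega) (run t (history S t omega))))); last first.
  by apply/funext => omega; rewrite -stateE.
rewrite (expectation_history_next _ _ mS indepS t (fun b B =>
  pot (dfsdca_step A phi lambda p theta B (run t b)))).
rewrite lee_fin mulr_sumr; apply: ler_sum => b _; rewrite [leRHS]mulrCA.
apply: ler_wpM2l; first exact: law_ge0.
under eq_bigr do rewrite law_Shat.
(* Along each fixed history the primal-dual relation holds, as [expected_step] requires. *)
have := dual_average A phi lambda lambda_gt0 p theta p_gt0 alpha0 (path_of t b) t.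
rewrite -/(run t b); case: (run t b) => alpha w /= wE.
apply: (expected_step A phi lambda l wstar lambda_gt0 dphi l_gt0 lphi wstar_min
  v p) => //.
- exact: sum_law.
- by move=> i; exact: incl_prob_law.
- move=> h; have := Shat_eso h.
  rewrite (expectation_finite_rv Pr Shat (fun B : {set 'I_n.+1} =>
    enorm (\sum_(i in B) A i *m h i) ^+ 2))//.
Qed.

Lemma mean_potential t :
  mean t pot <= expR (- theta * t%:R) * pot (dfsdca_init A lambda alpha0).
Proof.
have pot_ge0 s : 0 <= pot s by exact: potential_ge0.
have mean_ge0 t' : 0 <= mean t' pot.
  by apply: sumr_ge0 => b _; rewrite mulr_ge0// law_ge0.
elim: t => [|t IH].
  rewrite mulr0 expR0 mul1r /mean /run /= -mulr_suml sum_law ?mul1r//.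
  exact: history_finite_rv.
apply: (le_trans (mean_potential_step t)).
(* Nonnegativity of the mean allows [1 - theta] to be replaced by the larger [expR (- theta)]. *)
apply: (@le_trans _ _ (expR (- theta) * mean t pot)).
  by rewrite ler_wpM2r// expR_ge1Dx.
have -> : - theta * t.+1%:R = - theta + - theta * t%:R by rewrite -natr1; ring.
by rewrite expRD -mulrA ler_wpM2l// expR_ge0.
Qed.

Lemma mean_gap (L : 'I_n.+1 -> R) t :
  0 < fmax L + lambda ->
  (forall i, lipschitz_grad (L i) (composite_loss A phi i)) ->
  mean t (fun s => primal A phi lambda s.2 - primal A phi lambda wstar) <=
  (fmax L + lambda) / lambda * mean t pot.
Proof.
move=> L0 LL; rewrite mulr_sumr; apply: ler_sum => b _; rewrite [leRHS]mulrCA.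
apply: ler_wpM2l; first exact: law_ge0.
exact: primal_gap_potential.
Qed.

End Dfsdca.

Theorem theorem2 (R : realType) (n d m : nat)
    (A : 'I_n.+1 -> 'M[R]_(d, m)) (phi : 'I_n.+1 -> 'cV[R]_m -> R) (lambda : R)
    (disp : measure_display) (Omega : measurableType disp)
    (Pr : probability Omega R)
    (Shat : Omega -> {set 'I_n.+1}) (S : nat -> Omega -> {set 'I_n.+1})
    (v l : 'I_n.+1 -> R) (wstar : 'cV[R]_d) (alpha0 : 'I_n.+1 -> 'cV[R]_m)
    (theta : R)
    (p := incl_prob Pr Shat)
    (theta_max := fmin (fun i => p i * n.+1%:R * lambda /
                                 (l i * v i + n.+1%:R * lambda)))
    (state := fun t omega =>
       dfsdca A phi lambda p theta alpha0 (fun k => S k omega) t)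
    (E := fun t omega => potential A phi lambda l wstar (state t omega))
    (E0 := potential A phi lambda l wstar (dfsdca_init A lambda alpha0)) :
  0 < lambda ->
  (forall i x, differentiable (phi i) x) ->
  random_subset Shat ->
  (forall i, 0 < p i) ->
  (forall i, 0 < v i) ->
  eso Pr A Shat v ->
  (forall t, random_subset (S t)) ->
  (forall t, same_law Pr (S t) Shat) ->
  mutually_independent Pr S ->
  (forall i, convex_function [set: convex_lmodType 'cV[R]_m] (phi i)) ->
  (forall i, 0 < l i) ->
  (forall i, lipschitz_grad (l i) (phi i)) ->
  (forall w, primal A phi lambda wstar <= primal A phi lambda w) ->
  0 < theta ->
  theta <= theta_max ->
  (forall t : nat, ('E_Pr[E t] <= (expR (- theta * t%:R) * E0)%:E)%E) /\
  (theta = theta_max ->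
   forall L : 'I_n.+1 -> R,
   (forall i, 0 < L i) ->
   (forall i, lipschitz_grad (L i) (composite_loss A phi i)) ->
   forall (eps : R) (T : nat),
   0 < eps ->
   fmax (fun i => 1 / p i + l i * v i / (lambda * p i * n.+1%:R)) *
     ln ((fmax L + lambda) * E0 / (lambda * eps)) <= T%:R ->
   ('E_Pr[fun omega => (primal A phi lambda (state T omega).2
                        - primal A phi lambda wstar)%R] <= eps%:E)%E).
Proof.
move=> lambda0 dphi mShat p0 v0 Seso mS Slaw indepS cphi l0 lphi wmin th0 thle.
have dphi' i := differentiable_has_gradient (phi i) (dphi i).
have theta_le i : theta <=
    p i * n.+1%:R * lambda / (l i * v i + n.+1%:R * lambda).
  by rewrite (le_trans thle)//; exact: bigmin_le.
have N0 : 0 < n.+1%:R :> R by [].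
have mpot := mean_potential Pr A phi lambda theta v l wstar Shat S alpha0
  lambda0 dphi' l0 lphi wmin cphi mShat p0 v0 Seso mS Slaw indepS th0 theta_le.
have E0_ge0 : 0 <= E0 by exact: potential_ge0.
split=> [t|thE L L0 LL eps T eps0].
  by rewrite /E (expectation_state Pr A phi lambda theta Shat S alpha0 mS)
    lee_fin mpot.
have fL : 0 < fmax L + lambda.
  by rewrite addr_gt0// (lt_le_trans (L0 ord0))//; exact: le_bigmax.
(* Each term of the maximum is the inverse of the corresponding stepsize bound. *)
rewrite (_ : fmax _ = theta^-1); last first.
  rewrite thE -fmax_inv_fmin => [|i]; last first.
    by rewrite divr_gt0 ?addr_gt0 ?mulr_gt0.
  congr fmax; apply/funext => i; field.
  by rewrite !lt0r_neq0// addr_gt0// mulr_gt0.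
rewrite ler_pdivrMl// => Tle.
rewrite (expectation_state Pr A phi lambda theta Shat S alpha0 mS T
  (fun s => primal A phi lambda s.2 - primal A phi lambda wstar)) lee_fin.
have := mean_gap Pr A phi lambda theta l wstar Shat S alpha0
  lambda0 dphi' l0 lphi wmin L T fL LL.
move=> /le_trans; apply.
have c0 : 0 < (fmax L + lambda) / lambda by rewrite divr_gt0.
apply: (le_trans (ler_wpM2l (ltW c0) (mpot T))); rewrite -/E0.
(* The logarithm can be exponentiated back only for a positive argument, so a zero initial potential
   is treated apart. *)
have [->|E0_neq0] := eqVneq E0 0; first by rewrite !mulr0 ltW.
have E0_gt0 : 0 < E0 by rewrite lt_def E0_neq0.
have X0 : 0 < (fmax L + lambda) * E0 / (lambda * eps).
  by rewrite divr_gt0 ?mulr_gt0.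
move: Tle; rewrite -ler_expR lnK// => Tle.
rewrite mulNr expRN mulrCA ler_pdivrMl ?expR_gt0// -ler_pdivrMr//.
by apply: le_trans Tle; rewrite le_eqVlt; apply/orP; left; apply/eqP; field;
  rewrite !lt0r_neq0.
Qed.
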